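(* Let $G$ be a finite group. Then the inclusion graph $\mathcal I(G)$ is connected if and only if the intersection graph $\mathscr{I}(G)$ is connected.
   Context: For a finite group $G$, ''proper subgroup'' means a subgroup different from both the trivial subgroup and $G$ itself. The inclusion graph of subgroups $\mathcal I(G)$ is the simple graph whose vertices are the proper subgroups of $G$, two distinct vertices $H,K$ being adjacent if and only if $H\subset K$ or $K\subset H$. The intersection graph of subgroups $\mathscr{I}(G)$ is the simple graph with the same vertices, two distinct vertices $H,K$ being adjacent if and only if $|H\cap K|>1$. *)

(* Defs.v *)
From HB Require Import structures.
From mathcomp Require Import all_boot all_fingroup.

Set Implicit Arguments.
Unset Strict Implicit.
Unset Printing Implicit Defensive.

(* "Proper" excludes the trivial subgroup as well as G. This is not the        *)
(* library's [H \proper G], which only excludes G.                             *)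
Definition proper_subgroup (gT : finGroupType) (G H : {group gT}) : bool :=
  [&& H \subset G, H != 1%G & H != G].

Definition proper_subgroups (gT : finGroupType) (G : {group gT}) : finType :=
  {H : {group gT} | proper_subgroup G H}.

Definition inclusion_graph (gT : finGroupType) (G : {group gT}) :
    rel (proper_subgroups G) :=
  fun H K => (H != K) && ((val H \subset val K) || (val K \subset val H)).

Definition intersection_graph (gT : finGroupType) (G : {group gT}) :
    rel (proper_subgroups G) :=
  fun H K => (H != K) && (1 < #|val H :&: val K|).

(* The graph with no vertices counts as connected.                             *)
Definition connected_graph (V : finType) (e : rel V) : Prop :=
  forall x y : V, connect e x y.

Lemma inclusion_graph_sym (gT : finGroupType) (G : {group gT}) :
  symmetric (@inclusion_graph gT G).
Proof. by move=> H K; rewrite /inclusion_graph eq_sym orbC. Qed.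

Lemma inclusion_graph_irrefl (gT : finGroupType) (G : {group gT}) :
  irreflexive (@inclusion_graph gT G).
Proof. by move=> H; rewrite /inclusion_graph eqxx. Qed.

Lemma intersection_graph_sym (gT : finGroupType) (G : {group gT}) :
  symmetric (@intersection_graph gT G).
Proof. by move=> H K; rewrite /intersection_graph eq_sym setIC. Qed.

Lemma intersection_graph_irrefl (gT : finGroupType) (G : {group gT}) :
  irreflexive (@intersection_graph gT G).
Proof. by move=> H; rewrite /intersection_graph eqxx. Qed.

(* Main.v *)
Require Import Defs.
From HB Require Import structures.
From mathcomp Require Import all_boot all_fingroup.

(** The two graphs have the same connected components.  An inclusion [H <= K]
    of nontrivial subgroups gives [H :&: K = H], which is nontrivial, so every
    inclusion edge is an intersection edge.  Conversely, if [H :&: K] is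
    nontrivial it is itself a vertex, being contained in the proper subgroup [H] and
    hence different from [G]; it is contained in both [H] and [K], so it links them in the
    inclusion graph. *)

Lemma inclusion_sub_intersection (gT : finGroupType) (G : {group gT}) :
  subrel (@inclusion_graph gT G) (@intersection_graph gT G).
Proof.
have nontrivial (H : proper_subgroups G) : 1 < #|val H|.
  by case/and3P: (valP H) => _ ntH _; rewrite cardG_gt1.
move=> H K /andP[neqHK /orP[sHK | sKH]]; rewrite /intersection_graph neqHK.
  by rewrite (setIidPl sHK) nontrivial.
by rewrite (setIidPr sKH) nontrivial.
Qed.

(** Allowing [H = K] here spares a case distinction below, where [H :&: K] may
    coincide with [H] or with [K]. *)
Lemma connect_inclusion_subset (gT : finGroupType) (G : {group gT})
    (H K : proper_subgroups G) :
  val H \subset val K -> connect (@inclusion_graph gT G) H K.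
Proof.
move=> sHK; have [-> | neqHK] := eqVneq H K; first exact: connect0.
by apply: connect1; rewrite /inclusion_graph neqHK sHK.
Qed.

Lemma proper_subgroup_capl (gT : finGroupType) (G H K : {group gT}) :
  proper_subgroup G H -> 1 < #|H :&: K| -> proper_subgroup G (H :&: K)%G.
Proof.
case/and3P=> sHG _ neqHG ntHK; apply/and3P; split.
- exact: subset_trans (subsetIl H K) sHG.
- by rewrite -cardG_gt1 in ntHK *.
apply: contraNneq neqHG => eqIG; rewrite -val_eqE eqEsubset sHG /=.
by rewrite -eqIG subsetIl.
Qed.

Lemma intersection_connect_inclusion (gT : finGroupType) (G : {group gT}) :
  subrel (@intersection_graph gT G) (connect (@inclusion_graph gT G)).
Proof.
move=> H K /andP[_ ntHK].
pose L : proper_subgroups G := Sub _ (proper_subgroup_capl _ _ _ _ (valP H) ntHK).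
apply: (@connect_trans _ _ L).
  rewrite (sym_connect_sym (@inclusion_graph_sym _ G)).
  by apply: connect_inclusion_subset; apply: subsetIl.
by apply: connect_inclusion_subset; apply: subsetIr.
Qed.

Theorem theorem2p9 (gT : finGroupType) (G : {group gT}) :
  connected_graph (@inclusion_graph gT G) <->
  connected_graph (@intersection_graph gT G).
Proof.
split=> conn H K.
  apply: connect_sub (conn H K) => A B /inclusion_sub_intersection.
  exact: connect1.
exact: connect_sub (@intersection_connect_inclusion _ G) _ _ (conn H K).
Qed.
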